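(* Let $a<b$ be integers, $\mathbf{I}=\{a,\dots,b\}$, $\mathbf{I}^*=\{a+\tfrac12,\dots,b-\tfrac12\}$ and $\beta>0$. The massive s-holomorphic propagator $P_\beta:(\mathbb{R}^2)^{\mathbf{I}^*}\to(\mathbb{R}^2)^{\mathbf{I}^*}$ is symmetric (with respect to the standard Euclidean inner product), with eigenvalues $\lambda_\alpha^{\pm1}$, $\alpha=1,\dots,|\mathbf{I}^*|$, where the $\lambda_\alpha>1$ are distinct.
   Context: **Massive s-holomorphicity.** Edges of the square lattice are identified with their midpoints in $\mathbb{C}$. Set $\lambda=e^{i\pi/4}$ and $\nu=\lambda^{-3}\frac{e^{-2\beta}+i}{e^{-2\beta}-i}$. A function $F$ on the edges is massive s-holomorphic (parameter $\beta$) on a face with center $c$ and edges $E=c+\frac12$, $N=c+\frac i2$, $W=c-\frac12$, $S=c-\frac i2$ if $F(N)+\nu^{-1}\lambda\overline{F(N)}=\nu^{-1}F(E)+\lambda\overline{F(E)}$, $F(N)+\nu\lambda^{-1}\overline{F(N)}=\nu F(W)+\lambda^{-1}\overline{F(W)}$, $F(S)+\nu\lambda^{3}\overline{F(S)}=\nu F(E)+\lambda^{3}\overline{F(E)}$, $F(S)+\nu^{-1}\lambda^{-3}\overline{F(S)}=\nu^{-1}F(W)+\lambda^{-3}\overline{F(W)}$. **Propagator.** Write $\mathbf{I}^*_y=\{k+iy:k\in\mathbf{I}^*\}$ and $\mathbf{I}_{1/2}=\{x+\frac i2:x\in\mathbf{I}\}$. Every $f:\mathbf{I}^*_0\to\mathbb{C}$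 has a unique extension $h$ to $\mathbf{I}^*_0\cup\mathbf{I}_{1/2}\cup\mathbf{I}^*_1$ that is massive s-holomorphic on all faces $k+\frac i2$, $k\in\mathbf{I}^*$, and satisfies the Riemann boundary condition $h\parallel\tau_{cw}^{-1/2}$ on the two vertical boundary edges ($\tau_{cw}$ the clockwise unit tangent of the box), i.e. $h(a+\frac i2)\in\mathbb{R}\lambda^{-1}$ and $h(b+\frac i2)\in\mathbb{R}\lambda$. Identifying $\mathbb{C}\cong\mathbb{R}^2$, $P_\beta$ is the real-linear map $f\mapsto h|_{\mathbf{I}^*_1}$. *)

(* Defs.v *)
From HB Require Import structures.
From mathcomp Require Import all_boot all_order all_algebra.
From mathcomp Require Import all_classical all_reals all_analysis.
From mathcomp Require Import complex.
From mathcomp Require Import ring lra.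

Set Implicit Arguments.
Unset Strict Implicit.
Unset Printing Implicit Defensive.
Import Order.TTheory GRing.Theory Num.Theory.
Local Open Scope complex_scope.
Local Open Scope ring_scope.

(* [Rcomplex R] is [R[i]] with its structure of real vector space; this is the
   identification of C with R^2 through (Re, Im). *)
Section RcomplexVector.
Variable R : rcfType.

Fact Rcomplex_vect_iso : Vector.axiom 2 (Rcomplex R).
Proof.
exists (fun z : Rcomplex R =>
          \row_(j < 2) (if j == 0 then complex.Re z else complex.Im z)).
  move=> k [x y] [x' y']; apply/rowP => j; rewrite !mxE /=.
  by case: ifP.
exists (fun v : 'rV[R]_2 => (v 0 0 +i* v 0 1) : Rcomplex R).
  by move=> [x y]; rewrite !mxE.
move=> v; apply/rowP => j; rewrite !mxE /=.
case: ifP => [/eqP -> //|j0]; congr (v _ _); apply/val_inj.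
by case: j j0 => [[|[|j]]].
Qed.

HB.instance Definition _ :=
  Lmodule_hasFinDim.Build R (Rcomplex R) Rcomplex_vect_iso.

End RcomplexVector.

(* The number of points of I^* = {a + 1/2, ..., b - 1/2}, when a <= b. *)
Definition width (a b : int) : nat := `|b - a|%N.

(* (R^2)^{I^*} *)
Notation config R a b := {ffun 'I_(width a b) -> Rcomplex R}.

Section Propagator.
Variable R : realType.
Implicit Types (a b : int) (beta : R) (F h : R[i] -> R[i]).

(* exp (i pi / 4) *)
Definition lambda : R[i] := cos (pi / 4) +i* sin (pi / 4).

Definition nu beta : R[i] :=
  let t := (expR (- (2 * beta)))%:C in lambda ^- 3 * ((t + 'i) / (t - 'i)).

(* Edges are identified with their midpoints, so a function on edges is a
   function on complex numbers of which only the values at midpoints matter. *)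
Definition massive_s_holomorphic beta F (c : R[i]) : Prop :=
  let l := lambda in let n := nu beta in
  let E := F (c + 2^-1) in let N := F (c + 'i / 2) in
  let W := F (c - 2^-1) in let S := F (c - 'i / 2) in
  [/\ N + n^-1 * l * N^* = n^-1 * E + l * E^*,
      N + n * l^-1 * N^* = n * W + l^-1 * W^*,
      S + n * l ^+ 3 * S^* = n * E + l ^+ 3 * E^* &
      S + n^-1 * l ^- 3 * S^* = n^-1 * W + l ^- 3 * W^*].

(* The point k + iy, for the element k = a + j + 1/2 of I^*. *)
Definition dual_pt a (y : R) (j : nat) : R[i] :=
  (a%:~R + j%:R + 2^-1) +i* y.

(* The point a + j + i/2, midpoint of a vertical edge. *)
Definition vert_pt a (j : nat) : R[i] := (a%:~R + j%:R) +i* 2^-1.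

Definition config_dot a b (f g : config R a b) : R :=
  \sum_k (complex.Re (f k) * complex.Re (g k)
          + complex.Im (f k) * complex.Im (g k)).

(* h extends f to the edges of the row, is massive s-holomorphic on each of its
   faces, and satisfies the Riemann boundary condition: the clockwise tangent
   tau is i on the left side and -i on the right side, so the directions
   tau^{-1/2} are those of lambda^{-1} and lambda. *)
Definition is_extension a b beta (f : config R a b) h : Prop :=
  [/\ forall k : 'I_(width a b), h (dual_pt a 0 k) = f k,
      forall k : 'I_(width a b),
        massive_s_holomorphic beta h (dual_pt a 2^-1 k),
      exists r : R, h (a%:~R +i* 2^-1) = r%:C * lambda^-1 &
      exists r : R, h (b%:~R +i* 2^-1) = r%:C * lambda].

Lemma conjE (z : R[i]) : z^* = conjc z. Proof. by []. Qed.

Lemma imE : 'i = 0 +i* 1 :> R[i]. Proof. by []. Qed.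

Lemma conj_real (x : R) : x%:C^* = x%:C. Proof. exact: conjc_real. Qed.

Lemma lambda_sqr : lambda ^+ 2 = 'i.
Proof.
have e : pi / 4 + pi / 4 = pi / 2 :> R by lra.
have c : cos (pi / 4) * cos (pi / 4) - sin (pi / 4) * sin (pi / 4) = 0 :> R.
  by rewrite -cosD e cos_pihalf.
have s : cos (pi / 4) * sin (pi / 4) + sin (pi / 4) * cos (pi / 4) = 1 :> R.
  by rewrite addrC -sinD e sin_pihalf.
by rewrite expr2 /lambda; simpc; rewrite c s.
Qed.

Lemma sqrci : ('i : R[i]) ^+ 2 = -1. Proof. exact: sqr_i. Qed.

Lemma lambda_neq0 : lambda != 0.
Proof.
apply/eqP => l0; have := lambda_sqr; rewrite l0 expr0n /= => -[] /eqP.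
by rewrite eq_sym oner_eq0.
Qed.

Lemma lambda_conj : lambda^* = lambda^-1.
Proof.
apply: (mulfI lambda_neq0); rewrite mulfV ?lambda_neq0 // /lambda; simpc.
have := cos2Dsin2 (pi / 4 : R); rewrite !expr2 => ->.
by congr (_ +i* _); ring.
Qed.

Lemma tDi_neq0 (t : R) : t%:C + 'i != 0.
Proof. by rewrite eq_complex /=; apply/negP => /andP[_ /eqP]; lra. Qed.

Lemma tBi_neq0 (t : R) : t%:C - 'i != 0.
Proof. by rewrite eq_complex /=; apply/negP => /andP[_ /eqP]; lra. Qed.

Lemma nu_neq0 beta : nu beta != 0.
Proof.
by rewrite /nu mulf_neq0 ?invr_eq0 ?expf_neq0 ?lambda_neq0 // mulf_neq0
   ?invr_eq0 ?tDi_neq0 ?tBi_neq0.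
Qed.

Lemma nu_conj beta : (nu beta)^* = (nu beta)^-1.
Proof.
rewrite /nu; move: lambda lambda_neq0 lambda_conj => l l0 lc; set t := expR _.
have tc : (t%:C + 'i)^* = t%:C - 'i by rewrite rmorphD /= conj_real conjCi.
have hD := tDi_neq0 t; have hB := tBi_neq0 t.
move: (_ + _) (_ - _) tc hD hB => z w zc z0 w0.
have wc : w^* = z by rewrite -zc conjCK.
rewrite !(rmorphM, fmorphV, rmorphXn) /= lc zc wc.
by field; rewrite z0 w0 l0.
Qed.

Lemma nu_sqr beta : exists t : R, [/\ 0 < t, (0 < beta -> t < 1) &
  nu beta ^+ 2 * (t%:C - 'i) ^+ 2 = 'i * (t%:C + 'i) ^+ 2].
Proof.
exists (expR (- (2 * beta))); split; first exact: expR_gt0.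
  by move=> hb; rewrite expR_lt1; lra.
rewrite /nu; set t := expR _.
have hB := tBi_neq0 t; have l0 := lambda_neq0.
have l6 : lambda ^- 6 = 'i.
  have i0 : ('i : R[i]) != 0 by rewrite -lambda_sqr expf_neq0.
  apply: (mulIf (expf_neq0 6 l0)); rewrite mulVf ?expf_neq0 //.
  have -> : lambda ^+ 6 = (lambda ^+ 2) ^+ 3 by rewrite -exprM.
  by rewrite lambda_sqr -exprS (exprM _ 2 2) sqrci sqrrN expr1n.
transitivity (lambda ^- 6 * (t%:C + 'i) ^+ 2); last by rewrite l6.
move: l0 hB; move: lambda (t%:C + 'i) (t%:C - 'i) => l z w l0 w0.
by field; rewrite w0 l0.
Qed.

Lemma nu_sqr_neq1 beta : 0 < beta -> nu beta ^+ 2 != lambda ^+ 2.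
Proof.
move=> hb; have [t [t0 _ ht]] := nu_sqr beta; apply/eqP => e.
move: ht; rewrite e lambda_sqr => /(congr1 (fun z => complex.Re z)).
rewrite !expr2; simpc => /=; nra.
Qed.

Lemma nu_sqr_neq3 beta : 0 < beta -> nu beta ^+ 2 != lambda ^+ 6.
Proof.
move=> hb; have [t [t0 /(_ hb) t1 ht]] := nu_sqr beta; apply/eqP => e.
have l6 : lambda ^+ 6 = - 'i.
  have -> : lambda ^+ 6 = (lambda ^+ 2) ^+ 3 by rewrite -exprM.
  by rewrite lambda_sqr exprS sqrci mulrN1.
move: ht; rewrite e l6 => /(congr1 (fun z => complex.Im z)).
rewrite !expr2; simpc => /=; nra.
Qed.

Lemma lines_meet (p q r s : R[i]) :
    p != 0 -> q != 0 -> p^* = p^-1 -> q^* = q^-1 -> p ^+ 2 != q ^+ 2 ->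
    r^* = (p * q)^-1 * r -> s^* = p * q * s ->
  exists v, p * v + q * v^* = r /\ p^-1 * v + q^-1 * v^* = s.
Proof.
move=> p0 q0 pc qc; rewrite -subr_eq0 => d0 rc sc.
have d0' : q ^+ 2 - p ^+ 2 != 0 by rewrite -opprB oppr_eq0.
pose v := (r / q - s * q) / (p / q - q / p).
have vc : v^* = (r / p - s * p) / (q / p - p / q).
  rewrite /v !(rmorphM, fmorphV, rmorphB) /= rc sc pc qc.
  by field; rewrite p0 q0 mulNr -!expr2 ?d0 ?d0'.
exists v; rewrite vc /v.
by split; field; rewrite p0 q0 !mulNr -!expr2 d0 d0'.
Qed.

Lemma lines_unique (p q v v' : R[i]) :
    p != 0 -> q != 0 -> p ^+ 2 != q ^+ 2 ->
    p * v + q * v^* = p * v' + q * v'^* ->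
    p^-1 * v + q^-1 * v^* = p^-1 * v' + q^-1 * v'^* ->
  v = v'.
Proof.
move=> p0 q0; rewrite -subr_eq0 => d0 e1 e2.
have e : (p ^+ 2 - q ^+ 2) * v = (p ^+ 2 - q ^+ 2) * v'.
  have -> : (p ^+ 2 - q ^+ 2) * v =
     p * (p * v + q * v^*) - p * q ^+ 2 * (p^-1 * v + q^-1 * v^*).
    by field; rewrite p0 q0.
  by rewrite e1 e2; field; rewrite p0 q0.
exact: mulfI e.
Qed.

Lemma real_multipleP (z u : R[i]) : u != 0 -> u^* = u^-1 ->
  (exists r : R, z = r%:C * u) <-> z^* * u = z * u^-1.
Proof.
move=> u0 uc; split=> [[r ->]|e].
  by rewrite rmorphM /= conj_real uc; field.
exists (complex.Re (z * u^-1)).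
have : (z * u^-1)^* = z * u^-1 by rewrite rmorphM fmorphV /= uc invrK.
move=> e'; rewrite -[LHS](mulfVK u0); congr (_ * _).
move: (z / u) e' => [x y]; rewrite conjE => -[] y0; congr (_ +i* _); lra.
Qed.

Lemma face_pts a (k : nat) : let c := dual_pt a 2^-1 k in
  [/\ c + 2^-1 = vert_pt a k.+1, c + 'i / 2 = dual_pt a 1 k,
      c - 2^-1 = vert_pt a k & c - 'i / 2 = dual_pt a 0 k].
Proof.
have e2 : (2^-1 : R[i]) = (2^-1)%:C by rewrite fmorphV rmorph_nat.
rewrite /dual_pt /vert_pt /= imE e2.
by split; simpc; congr (_ +i* _); rewrite -?natr1; field.
Qed.

Lemma vert_first a : vert_pt a 0 = a%:~R +i* 2^-1.
Proof. by rewrite /vert_pt addr0. Qed.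

Lemma vert_last a b : a < b -> vert_pt a (width a b) = b%:~R +i* 2^-1.
Proof.
move=> ab; rewrite /vert_pt; congr (_ +i* _).
rewrite -[X in _ + X]/((Posz (width a b))%:~R) -intrD /width.
by rewrite gez0_abs ?subr_ge0 ?ltW //; congr (_%:~R); ring.
Qed.

Lemma width_gt0 a b : a < b -> (0 < width a b)%N.
Proof. by move=> ab; rewrite /width absz_gt0 subr_eq0 gt_eqF. Qed.

Lemma extension_exists a b beta (f : config R a b) :
  a < b -> 0 < beta -> exists h, is_extension beta f h.
Proof.
move=> ab hb.
have l0 := lambda_neq0; have n0 := nu_neq0 beta.
have lc := lambda_conj; have nc := nu_conj beta.
have nl : nu beta + lambda != 0.
  by apply: contra (nu_sqr_neq1 hb); rewrite addr_eq0 => /eqP ->; rewrite sqrrN.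
have nl1 := nu_sqr_neq1 hb; have nl3 := nu_sqr_neq3 hb.
rewrite /is_extension /massive_s_holomorphic.
move: n0 nc nl nl1 nl3 l0 lc; move: (nu beta) lambda.
move=> n l n0 nc nl nl1 nl3 l0 lc.
have l30 : l ^+ 3 != 0 by rewrite expf_neq0.
have l3c : (l ^+ 3)^* = (l ^+ 3)^-1 by rewrite rmorphXn /= lc exprVn.
pose fb j : R[i] := if insub j is Some k then f k else 0.
have [r rE] : exists r, forall j, r j = fb j + n * l ^+ 3 * (fb j)^*.
  by exists (fun j => fb j + n * l ^+ 3 * (fb j)^*).
have [s sE] : exists s, forall j, s j = fb j + n^-1 * l ^- 3 * (fb j)^*.
  by exists (fun j => fb j + n^-1 * l ^- 3 * (fb j)^*).
have rc j : (r j)^* = (n * l ^+ 3)^-1 * r j.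
  rewrite rE !(rmorphD, rmorphM) /= conjCK nc !lc.
  by field; rewrite n0 l0.
have sc j : (s j)^* = n * l ^+ 3 * s j.
  rewrite sE !(rmorphD, rmorphM, fmorphV) /= conjCK nc !lc !invrK.
  by field; rewrite n0 l0.
have inner j : exists v, n * v + l ^+ 3 * v^* = r j /\
    n^-1 * v + (l ^+ 3)^-1 * v^* = s j.+1.
  by apply: lines_meet; rewrite ?rc ?sc // -exprM.
have left : exists v, n^-1 * v + l ^- 3 * v^* = s 0%N /\
    exists x : R, v = x%:C * l^-1.
  pose v := s 0%N / (n^-1 + l^-1).
  have d0 : l + n != 0 by rewrite addrC.
  have vc : v^* = l ^+ 2 * v.
    rewrite /v !(rmorphD, rmorphM, fmorphV) /= sc nc lc.
    by field; rewrite ?n0 ?l0 ?d0 ?nl.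
  exists v; split; first by rewrite vc /v; field; rewrite ?n0 ?l0 ?d0 ?nl.
  have li0 : l^-1 != 0 by rewrite invr_eq0.
  have lic : (l^-1)^* = l^-1^-1 by rewrite fmorphV /= lc.
  by apply/(real_multipleP _ li0 lic); rewrite vc; field.
have right j : exists v, n * v + l ^+ 3 * v^* = r j /\
    exists x : R, v = x%:C * l.
  pose v := r j / (n + l).
  have d0 : l + n != 0 by rewrite addrC.
  have vc : v^* = l ^- 2 * v.
    rewrite /v !(rmorphD, rmorphM, fmorphV) /= rc nc lc.
    by field; rewrite ?n0 ?l0 ?d0 ?nl.
  exists v; split; first by rewrite vc /v; field; rewrite ?n0 ?l0 ?d0 ?nl.
  by apply/(real_multipleP _ l0 lc); rewrite vc; field.
have [vl [vlE vlR]] := left.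
have [vi viE] := boolp.choice inner; have [vr vrE] := boolp.choice right.
pose v j := if j is j'.+1 then
  if j == width a b then vr j' else vi j' else vl.
have vE j : n * v j.+1 + l ^+ 3 * (v j.+1)^* = r j.
  by rewrite /v; case: ifP => _; [have [] := vrE j | have [] := viE j].
have vW j : (j < width a b)%N -> n^-1 * v j + l ^- 3 * (v j)^* = s j.
  case: j => [|j] hj; first by [].
  by rewrite /v (ltn_eqF hj); have [] := viE j.
have upper j : exists w,
    1 * w + (n^-1 * l) * w^* = n^-1 * v j.+1 + l * (v j.+1)^* /\
    1^-1 * w + (n^-1 * l)^-1 * w^* = n * v j + l^-1 * (v j)^*.
  apply: lines_meet; rewrite ?oner_eq0 ?mulf_neq0 ?invr_eq0 //.
  - by rewrite rmorph1 invr1.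
  - by rewrite rmorphM fmorphV /= nc lc invfM.
  - apply: contra nl1; rewrite expr1n => /eqP e.
    by rewrite -[X in X == _]mulr1 e; apply/eqP; field.
  - rewrite !(rmorphD, rmorphM, fmorphV) /= conjCK nc lc.
    by field; rewrite n0 l0.
  rewrite !(rmorphD, rmorphM, fmorphV) /= conjCK nc lc.
  by field; rewrite n0 l0.
have [w wE] := boolp.choice upper.
pose idx (x : R) := Num.truncn x.
have idxK j x : x = j%:R -> idx x = j by move=> ->; rewrite /idx natrK.
pose h (z : R[i]) : R[i] :=
  if complex.Im z == 0 then fb (idx (complex.Re z - 2^-1 - a%:~R)) else
  if complex.Im z == 1 then w (idx (complex.Re z - 2^-1 - a%:~R)) else
  v (idx (complex.Re z - a%:~R)).
have h0 j : h (dual_pt a 0 j) = fb j.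
  by rewrite /h /= eqxx; congr fb; apply: idxK; field.
have h1 j : h (dual_pt a 1 j) = w j.
  by rewrite /h /= oner_eq0 eqxx; congr w; apply: idxK; field.
have hv j : h (vert_pt a j) = v j.
  rewrite /h /= invr_eq0 pnatr_eq0 /= ifF; last by apply/eqP; lra.
  by congr v; apply: idxK; ring.
exists h; split.
- by move=> k; rewrite h0 /fb valK.
- move=> k.
  have [-> -> -> ->] := face_pts a k; rewrite h0 h1 !hv.
  have [] := wE k; rewrite invr1 !mul1r => -> e2.
  split=> //; rewrite -?rE -?sE ?vE ?vW //.
  by rewrite -e2; congr (_ + _); field; rewrite n0 l0.
- by rewrite -vert_first hv.
rewrite -(vert_last ab) hv.
have := width_gt0 ab; case e : (width a b) => [//|m] _.
by rewrite /v e eqxx; have [] := vrE m.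
Qed.

Lemma extension_unique a b beta (f : config R a b) h h' :
    a < b -> 0 < beta -> is_extension beta f h -> is_extension beta f h' ->
  (forall j, (j <= width a b)%N -> h (vert_pt a j) = h' (vert_pt a j)) /\
  (forall k : 'I_(width a b), h (dual_pt a 1 k) = h' (dual_pt a 1 k)).
Proof.
move=> ab hb [hf hs hl hr] [hf' hs' hl' hr'].
have l0 := lambda_neq0; have n0 := nu_neq0 beta.
have lc := lambda_conj.
have nl : nu beta + lambda != 0.
  by apply: contra (nu_sqr_neq1 hb); rewrite addr_eq0 => /eqP ->; rewrite sqrrN.
have nl1 := nu_sqr_neq1 hb; have nl3 := nu_sqr_neq3 hb.
move: hs hs'; rewrite /massive_s_holomorphic.
set n := nu beta in n0 nl nl1 nl3 *; set l := lambda in l0 lc nl nl1 nl3 *.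
move=> hs hs'.
have ev k (hk : (k < width a b)%N) :
    n * h (vert_pt a k.+1) + l ^+ 3 * (h (vert_pt a k.+1))^* =
    n * h' (vert_pt a k.+1) + l ^+ 3 * (h' (vert_pt a k.+1))^*.
  have := hs (Ordinal hk); have := hs' (Ordinal hk).
  have [-> -> -> ->] := face_pts a k; rewrite (hf (Ordinal hk)) (hf' (Ordinal hk)).
  by move=> [_ _ <- _] [_ _ <- _].
have wv k (hk : (k < width a b)%N) :
    n^-1 * h (vert_pt a k) + l ^- 3 * (h (vert_pt a k))^* =
    n^-1 * h' (vert_pt a k) + l ^- 3 * (h' (vert_pt a k))^*.
  have := hs (Ordinal hk); have := hs' (Ordinal hk).
  have [-> -> -> ->] := face_pts a k; rewrite (hf (Ordinal hk)) (hf' (Ordinal hk)).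
  by move=> [_ _ _ <-] [_ _ _ <-].
have eqv j : (j <= width a b)%N -> h (vert_pt a j) = h' (vert_pt a j).
  case: (eqVneq j 0%N) => [-> _|j0].
    move: hl hl' (wv 0%N (width_gt0 ab)); rewrite -vert_first.
    have li0 : l^-1 != 0 by rewrite invr_eq0.
    have lic : (l^-1)^* = l^-1^-1 by rewrite fmorphV /= lc.
    move=> /(real_multipleP _ li0 lic) + /(real_multipleP _ li0 lic).
    move: (h _) (h' _) => x x' /(canRL (mulfK li0)) -> /(canRL (mulfK li0)) -> e.
    apply: (@mulfI _ (n^-1 * l^-1 * (n + l))).
      by rewrite !mulf_neq0 ?invr_eq0.
    transitivity (n^-1 * x + l ^- 3 * (x / l^-1 / l^-1)).
      by field; rewrite n0 l0.
    by rewrite e; field; rewrite n0 l0.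
  case: j j0 => [//|j] _; rewrite leq_eqVlt => /orP[/eqP ej|hj].
    move: hr hr' (ev j); rewrite -(vert_last ab) -ej ltnSn.
    move=> /(real_multipleP _ l0 lc) + /(real_multipleP _ l0 lc).
    move: (h _) (h' _) => x x' /(canRL (mulfK l0)) -> /(canRL (mulfK l0)) -> /(_ isT) e.
    apply: (mulfI nl).
    transitivity (n * x + l ^+ 3 * (x / l / l)); first by field.
    by rewrite e; field.
  apply: (@lines_unique n (l ^+ 3)); rewrite ?expf_neq0 // -?exprM //.
    exact/ev/ltnW.
  exact: wv.
split=> // k; have := hs k; have := hs' k.
have [-> -> -> ->] := face_pts a k.
rewrite !eqv ?(ltnW (ltn_ord k)) //.
move=> [e1 e2 _ _] [e1' e2' _ _].
apply: (@lines_unique 1 (n^-1 * l)); rewrite ?oner_eq0 ?mulf_neq0 ?invr_eq0 //.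
- apply: contra nl1; rewrite expr1n => /eqP e.
  by rewrite -[X in X == _]mulr1 e; apply/eqP; field.
- by rewrite !mul1r e1 e1'.
rewrite invr1 !mul1r invfM invrK [in LHS]e2' [in RHS]e2.
by [].
Qed.

(* Only the values of an extension on the edges of the row are determined; the
   choice made here does not matter, by [propagator_funE]. *)
Section Fixed.
Variables (a b : int) (hab : a < b) (beta : R) (hbeta : 0 < beta).

Definition extension (f : config R a b) : R[i] -> R[i] :=
  projT1 (cid (extension_exists f hab hbeta)).

Lemma extensionP f : is_extension beta f (extension f).
Proof. exact: projT2 (cid (extension_exists f hab hbeta)). Qed.

Definition propagator_fun (f : config R a b) : config R a b :=
  [ffun k : 'I_(width a b) => extension f (dual_pt a 1 k) : Rcomplex R].

Lemma propagator_funE f h : is_extension beta f h ->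
  forall k, propagator_fun f k = h (dual_pt a 1 k).
Proof.
move=> fh k; rewrite ffunE.
by have [_ ->] := extension_unique hab hbeta (extensionP f) fh.
Qed.

Fact propagator_fun_is_linear : linear propagator_fun.
Proof.
move=> x f g.
have scE (z : Rcomplex R) : x *: z = x%:C * z :> R[i].
  by case: z => u v; simpc.
pose h z := x%:C * extension f z + extension g z.
have hE : is_extension beta (x *: f + g) h.
  have [f1 f2 [rf f3] [sf f4]] := extensionP f.
  have [g1 g2 [rg g3] [sg g4]] := extensionP g.
  split.
  - by move=> k; rewrite /h f1 g1 !ffunE scE.
  - move=> k; move: (f2 k) (g2 k); rewrite /massive_s_holomorphic /h.
    have cE (u v : R[i]) : (x%:C * u + v)^* = x%:C * u^* + v^*.
      by rewrite rmorphD rmorphM /= conj_real.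
    have lin (c d e u v u' v' : R[i]) :
        u + c * u^* = d * v + e * v^* -> u' + c * u'^* = d * v' + e * v'^* ->
        (x%:C * u + u') + c * (x%:C * u + u')^* =
        d * (x%:C * v + v') + e * (x%:C * v + v')^*.
      move=> e1 e2; rewrite !cE.
      transitivity (x%:C * (u + c * u^*) + (u' + c * u'^*)); first by ring.
      by rewrite e1 e2; ring.
    by move=> [? ? ? ?] [? ? ? ?]; split; apply: lin.
  - by exists (x * rf + rg); rewrite /h f3 g3 rmorphD rmorphM /=; ring.
  by exists (x * sf + sg); rewrite /h f4 g4 rmorphD rmorphM /=; ring.
apply/ffunP => k; rewrite (propagator_funE hE) !ffunE /h.
by rewrite scE.
Qed.

HB.instance Definition _ :=
  GRing.isLinear.Build R (config R a b) (config R a b) _ propagator_fun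
    propagator_fun_is_linear.

Definition propagator : 'End(config R a b) := linfun propagator_fun.

Lemma propagatorE f h : is_extension beta f h ->
  forall k, propagator f k = h (dual_pt a 1 k).
Proof. by rewrite lfunE; exact: propagator_funE. Qed.

End Fixed.

End Propagator.

(* Main.v *)
From HB Require Import structures.
Require Import Defs.
From mathcomp Require Import all_boot all_order all_algebra.
From mathcomp Require Import all_classical all_reals all_analysis.
From mathcomp Require Import complex spectral sesquilinear.
From mathcomp Require Import ring lra.

Set Implicit Arguments.
Unset Strict Implicit.
Unset Printing Implicit Defensive.
Import Order.TTheory GRing.Theory Num.Theory.
Local Open Scope complex_scope.
Local Open Scope ring_scope.

(* With t = exp (-2 beta), the relation between the rows f and P f is, in
   suitable real linear coordinates, a direct sum of hyperbolic rotations of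
   neighbouring sites: P = M^T B M / (2 t) with M block diagonal and B symmetric
   positive.  Hence P is symmetric and positive.  The reflection J exchanging
   real and imaginary parts satisfies J P J = P^-1, so the spectrum is closed
   under inversion.  An eigenvector is determined by its value at the leftmost
   site, which the left boundary condition confines to a line, so eigenspaces
   are lines and the symmetric P has as many eigenvalues as its dimension.
   Finally 1 is not an eigenvalue: a fixed vector satisfies y = - x everywhere
   by the left boundary condition, and y = x at the right end. *)

(** * Symmetric matrices with simple spectrum *)

Lemma symmetric_spectral (R : rcfType) m (A : 'M[R]_m) : A^T = A ->
  exists (P : 'M[R[i]]_m) (d : 'I_m -> R), P \in unitmx /\
    forall i, row i P *m map_mx (real_complex R) A = (d i)%:C%C *: row i P.
Proof.
(* Over [R[i]] a real symmetric matrix is Hermitian, so it is unitarily diagonalizable with real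
   eigenvalues. *)
move=> symA; set B := map_mx _ A.
have realB : B \is a realmx.
  by apply/mxOverP => i j; rewrite mxE complex_real.
have symB : B \is symmetricmx.
  by apply/is_hermitianmxP; rewrite expr0 scale1r map_mx_id // /B map_trmx symA.
have hermB := realsym_hermsym symB realB.
have /orthomx_spectralP B_eq := hermitian_normalmx hermB.
have /mxOverP d_real := hermitian_spectral_diag_real hermB.
exists (spectralmx B), (fun i => complex.Re (spectral_diag B 0 i)).
split=> [|i]; first exact: spectral_unit.
rewrite [X in _ *m X]B_eq !mulmxA -row_mul mulmxV ?spectral_unit // -row_mul mul1mx.
rewrite row_diag_mx -scalemxAl -rowE; congr (_ *: _).
by rewrite RRe_real.
Qed.

(** Extension of scalars to [R[i]] preserves the rank of eigenspaces. If [d i = d j] with [i] and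
    [j] distinct, two independent rows of [P] would lie in an eigenspace of rank at most 1. *)
Lemma symmetric_simple_spectrum (R : rcfType) m (A : 'M[R]_m) :
    A^T = A -> (forall mu, (\rank (eigenspace A mu) <= 1)%N) ->
  exists d : 'I_m -> R, injective d /\
    forall mu, eigenvalue A mu <-> exists i, mu = d i.
Proof.
move=> symA simpleA; have [P [d [Punit PA]]] := symmetric_spectral symA.
set f := real_complex R in PA; have fI : injective f := @fmorph_inj _ _ f.
have rowP_neq0 k : row k P != 0.
  apply/eqP=> /(congr1 (mulmx^~ (invmx P))); rewrite -row_mul mulmxV // mul0mx.
  by rewrite row1 => /rowP/(_ k)/eqP; rewrite !mxE !eqxx oner_eq0.
exists d; split=> [i j dij|mu].
  have sub k : d k = d i -> (row k P <= map_mx f (eigenspace A (d i)))%MS.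
    by move=> dk; rewrite map_eigenspace; apply/eigenspaceP; rewrite PA dk.
  have : (row j P <= row i P)%MS.
    apply: submx_trans (sub j (esym dij)) _.
    rewrite -(geq_leqif (mxrank_leqif_sup (sub i erefl))) mxrank_map.
    by rewrite (leq_trans (simpleA _)) // lt0n mxrank_eq0.
  case/sub_rVP=> c /(congr1 (mulmx^~ (invmx P))).
  rewrite -scalemxAl -!row_mul mulmxV // !row1 => /rowP/(_ j)/eqP.
  rewrite !mxE !eqxx; case: (j =P i) => [->//|_].
  by rewrite mulr0 oner_eq0.
rewrite -(eigenvalue_map f); split=> [/eigenvalueP[v vA v0]|[i ->]].
  (* In the coordinates [w] of [v] in the eigenbasis the matrix is diagonal, so a nonzero coordinate
     [i] forces [mu = d i]. *)
  pose w := v *m invmx P.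
  have vE : v = w *m P by rewrite mulmxKV.
  have /rV0Pn[i wi] : w != 0.
    by apply: contraNneq v0 => w0; rewrite vE w0 mul0mx.
  exists i; apply: fI; apply: (mulIf wi).
  have PAE : P *m map_mx f A = diag_mx (\row_k f (d k)) *m P.
    apply/row_matrixP => k; rewrite row_mul PA row_mul row_diag_mx mxE.
    by rewrite -scalemxAl -rowE.
  have /rowP/(_ i) : w *m diag_mx (\row_k f (d k)) = f mu *: w.
    rewrite -[LHS](mulmxK Punit) -[w *m _ *m P]mulmxA -PAE mulmxA -vE vA.
    by rewrite -scalemxAl.
  by rewrite mul_mx_diag !mxE mulrC => ->.
by apply/eigenvalueP; exists (row i P) => //; exact: PA.
Qed.

(** Rank-nullity: the linear form [c] embeds the eigenspace into a line. *)
Lemma mxrank_eigenspace_le1 (F : fieldType) m (A : 'M[F]_m) mu (c : 'cV[F]_m) :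
    (forall v : 'rV_m, v *m A = mu *: v -> v *m c = 0 -> v = 0) ->
  (\rank (eigenspace A mu) <= 1)%N.
Proof.
move=> inj_c; rewrite -(mxrank_mul_ker _ c).
suff -> : (eigenspace A mu :&: kermx c)%MS = 0.
  by rewrite mxrank0 addn0 rank_leq_col.
apply/eqP/rowV0P => v; rewrite sub_capmx => /andP[/eigenspaceP vA /sub_kermxP].
exact: inj_c.
Qed.

(** Inversion of values induces an involution [tau] of the indices that exchanges [A] with its
    complement, so [A] has exactly [n] elements. *)
Lemma enum_inverse_pairs (R : realFieldType) n (d : 'I_(n + n) -> R) :
    injective d -> (forall i, 0 < d i) -> (forall i, d i != 1) ->
    (forall i, exists j, d j = (d i)^-1) ->
  exists lam : 'I_n -> R,
    [/\ injective lam, forall k, 1 < lam k &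
        forall mu, (exists i, mu = d i) <->
          exists k, mu = lam k \/ mu = (lam k)^-1].
Proof.
move=> d_inj d_gt0 d_neq1 d_inv; pose A := [set i | 1 < d i].
pose tau i := odflt i [pick j | d j == (d i)^-1].
have tauE i : d (tau i) = (d i)^-1.
  rewrite /tau; case: pickP => [j /eqP //|no]; have [j dj] := d_inv i.
  by have := no j; rewrite dj eqxx.
have tauK : involutive tau by move=> i; apply: d_inj; rewrite !tauE invrK.
have tauA i : (tau i \in A) = (i \notin A).
  by rewrite !inE tauE invf_gt1 // -leNgt le_eqVlt (negPf (d_neq1 i)).
have tauAE : tau @: A = ~: A.
  apply/setP=> i; rewrite !inE; apply/imsetP/idP => [[j jA ->]|iA].
    by have := tauA j; rewrite [tau j \in A]inE jA => ->.
  by exists (tau i); rewrite ?tauK // tauA inE.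
have cardA : #|A| = n.
  have := cardsC A; rewrite -tauAE card_imset ?card_ord; last exact: inv_inj.
  by move=> e; apply: double_inj; rewrite -!addnn.
exists (fun k => d (enum_val (cast_ord (esym cardA) k))); split.
- by move=> k l /d_inj/enum_val_inj/cast_ord_inj.
- by move=> k; have := enum_valP (cast_ord (esym cardA) k); rewrite inE.
have surj i : i \in A -> exists k, i = enum_val (cast_ord (esym cardA) k).
  move=> iA; exists (cast_ord cardA (enum_rank_in iA i)).
  by rewrite cast_ordK enum_rankK_in.
move=> mu; split=> [[i ->]|[k [->|->]]]; last 2 first.
- by exists (enum_val (cast_ord (esym cardA) k)).
- by exists (tau (enum_val (cast_ord (esym cardA) k))); rewrite tauE.
have [/surj[k ->]|] := boolP (i \in A); first by exists k; left.
by rewrite -tauA => /surj[k e]; exists k; right; rewrite -e tauE invrK.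
Qed.

(** * The transfer relation in real coordinates *)

Section TransferRelation.
Variables (R : realFieldType) (t : R).
Implicit Types (z w : R[i]) (u v : nat -> R[i]).

Definition swap z : R[i] := complex.Im z +i* complex.Re z.

(* Up to nonzero factors, the real parts of the face equations that the bottom
   and top edges of a face share with its east and west edges. *)
Definition south_east z : R := t * complex.Re z + complex.Im z.
Definition south_west z : R := complex.Im z - t * complex.Re z.
Definition north_east z : R := t * complex.Im z + complex.Re z.
Definition north_west z : R := t * complex.Im z - complex.Re z.

(* The relation between the bottom row u and the top row v, on the sites
   0, ..., n, that remains after eliminating the vertical edges. *)
Definition transfers n u v : Prop :=
  [/\ north_west (v 0%N) = south_west (u 0%N),
      north_east (v n) = south_east (u n) &
      forall k, (k < n)%N ->
        (1 - t ^+ 2) * north_east (v k) =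
          (1 + t ^+ 2) * south_east (u k) - 2 * t * south_west (u k.+1) /\
        (1 - t ^+ 2) * north_west (v k.+1) =
          (1 + t ^+ 2) * south_west (u k.+1) - 2 * t * south_east (u k)].

Definition dotC z w : R :=
  complex.Re z * complex.Re w + complex.Im z * complex.Im w.

(** Up to the factor [2 * t], the north forms are dual to the south forms. Since [transfers] gives
    the north forms of the output in terms of the south forms of the input, inner products of
    outputs with inputs become bilinear in south forms. *)
Lemma dotC_transfer z w :
  2 * t * dotC z w = north_east z * south_east w + north_west z * south_west w.
Proof.
rewrite /dotC /north_east /north_west /south_east /south_west; ring.
Qed.

(** The terms are regrouped by vertical edge: the east forms of site [k] go with the west forms of
    site [k.+1], and the two boundary terms stand alone. *)
Lemma sum_dotC_transfer n u v :
  2 * t * (\sum_(k < n.+1) dotC (v k) (u k)) =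
    north_west (v 0%N) * south_west (u 0%N)
    + north_east (v n) * south_east (u n)
    + \sum_(k < n) (north_east (v k) * south_east (u k)
                    + north_west (v k.+1) * south_west (u k.+1)).
Proof.
rewrite mulr_sumr (eq_bigr _ (fun k _ => dotC_transfer _ _)) big_split /=.
by rewrite big_ord_recr big_ord_recl /= big_split /=; ring.
Qed.

Hypotheses (t_gt0 : 0 < t) (t_lt1 : t < 1).

Let t_neq0 : t != 0. Proof. by rewrite gt_eqF. Qed.

Let t2_neq0 : 2 * t != 0. Proof. by rewrite mulf_neq0 ?pnatr_eq0. Qed.

Let tB_gt0 : 0 < 1 - t. Proof. by rewrite subr_gt0. Qed.

Let tsq_gt0 : 0 < 1 - t ^+ 2. Proof. by rewrite subr_gt0 expr_lt1 ?ltW. Qed.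

Let tsq_neq0 : 1 - t ^+ 2 != 0. Proof. by rewrite gt_eqF. Qed.

(** Each vertical edge contributes a symmetric bilinear form in the south forms, with diagonal
    entries [1 + t ^+ 2] and off-diagonal entries [- 2 * t], over [1 - t ^+ 2]. *)
Lemma transfers_sym n u v u' v' : transfers n u v -> transfers n u' v' ->
  \sum_(k < n.+1) dotC (v k) (u' k) = \sum_(k < n.+1) dotC (v' k) (u k).
Proof.
move=> [v0 vn vk] [v0' vn' vk'].
apply: (mulfI t2_neq0); rewrite !sum_dotC_transfer v0 vn v0' vn'.
congr (_ + _); first by ring.
apply: eq_bigr => k _; apply: (mulfI tsq_neq0).
have [e1 e2] := vk k (ltn_ord k); have [e1' e2'] := vk' k (ltn_ord k).
rewrite ![(1 - t ^+ 2) * (_ + _)]mulrDr ![(1 - t ^+ 2) * (_ * _)]mulrA.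
move: (south_east (u k)) (south_west (u k.+1)) e1 e2 => a b -> ->.
by move: (south_east _) (south_west _) e1' e2' => a' b' -> ->; ring.
Qed.

Lemma transfers_psd n u v : transfers n u v ->
  0 <= \sum_(k < n.+1) dotC (v k) (u k).
Proof.
move=> [v0 vn vk]; have t2 : 0 < 2 * t by rewrite mulr_gt0.
rewrite -(pmulr_rge0 _ t2) sum_dotC_transfer v0 vn -!expr2.
rewrite !addr_ge0 ?sqr_ge0 // sumr_ge0 // => k _; rewrite -(pmulr_rge0 _ tsq_gt0).
have [e1 e2] := vk k (ltn_ord k); move: e1 e2.
move: (south_east _) (south_west _) (north_east _) (north_west _) => x y a b e1 e2.
(* The quadratic form [(1 + t ^+ 2) * (x ^+ 2 + y ^+ 2) - 4 * t * x * y] as a sum of squares. *)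
have -> : (1 - t ^+ 2) * (a * x + b * y)
  = (1 - t) ^+ 2 * (x ^+ 2 + y ^+ 2) + 2 * t * (x - y) ^+ 2.
  by rewrite mulrDr !mulrA e1 e2; ring.
by rewrite addr_ge0 // mulr_ge0 ?addr_ge0 ?sqr_ge0 // ltW.
Qed.

Lemma north_inj z w :
  north_east z = north_east w -> north_west z = north_west w -> z = w.
Proof.
case: z w => [x y] [x' y']; rewrite /north_east /north_west /= => e1 e2.
have -> : x = x' by lra.
by congr (_ +i* _); apply: (mulfI t_neq0); lra.
Qed.

Lemma transfers_unique n u v v' : transfers n u v -> transfers n u v' ->
  forall k, (k <= n)%N -> v k = v' k.
Proof.
move=> [v0 vn vk] [v0' vn' vk'] k kn; apply: north_inj.
  move: kn; rewrite leq_eqVlt => /predU1P[->|kn]; first by rewrite vn vn'.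
  by apply: (mulfI tsq_neq0); have [-> _] := vk k kn; have [-> _] := vk' k kn.
case: k kn => [|k] kn; first by rewrite v0 v0'.
by apply: (mulfI tsq_neq0); have [_ ->] := vk k kn; have [_ ->] := vk' k kn.
Qed.

(* Reflecting the row in its horizontal axis exchanges input and output. *)
Lemma transfers_swap n u v : transfers n u v ->
  transfers n (swap \o v) (swap \o u).
Proof.
have swapE z : [/\ north_east (swap z) = south_east z,
    north_west (swap z) = - south_west z,
    south_east (swap z) = north_east z &
    south_west (swap z) = - north_west z].
  rewrite /north_east /north_west /south_east /south_west /=.
  by split; ring.
have NE z : north_east (swap z) = south_east z by case: (swapE z).
have NW z : north_west (swap z) = - south_west z by case: (swapE z).
have SE z : south_east (swap z) = north_east z by case: (swapE z).
have SW z : south_west (swap z) = - north_west z by case: (swapE z).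
move=> [v0 vn vk]; split=> [||k kn] /=; rewrite !(NE, NW, SE, SW).
- by rewrite v0.
- by rewrite vn.
have [e1 e2] := vk k kn.
(* The matrix of the inner relation is a hyperbolic rotation. Its inverse differs only in the sign
   of the off-diagonal entries, which the signs of the swapped west forms absorb. *)
split; apply: (mulfI tsq_neq0).
  transitivity ((1 + t ^+ 2) * ((1 - t ^+ 2) * north_east (v k))
    + 2 * t * ((1 - t ^+ 2) * north_west (v k.+1))); last by ring.
  by rewrite e1 e2; ring.
transitivity (- (1 + t ^+ 2) * ((1 - t ^+ 2) * north_west (v k.+1))
  - 2 * t * ((1 - t ^+ 2) * north_east (v k))); last by ring.
by rewrite e1 e2; ring.
Qed.

Lemma transfers0 n : transfers n (fun=> 0) (fun=> 0).
Proof.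
rewrite /transfers /north_east /north_west /south_east /south_west /=.
by split=> [||k _]; rewrite !(mulr0, addr0, subr0).
Qed.

Lemma swap_eq0 z : swap z = 0 -> z = 0.
Proof. by case: z => x y [-> ->]. Qed.

(** Swapping turns this into uniqueness of the output for the input 0. *)
Lemma transfers_inj n u : transfers n u (fun=> 0) ->
  forall k, (k <= n)%N -> u k = 0.
Proof.
move=> /transfers_swap; rewrite /comp => h k kn.
have s0 : swap 0 = 0 by [].
have := transfers_unique h; rewrite s0 => /(_ _ (transfers0 n) k kn).
exact: swap_eq0.
Qed.

Lemma transfers_fixed n u : transfers n u u -> forall k, (k <= n)%N -> u k = 0.
Proof.
move=> [u0 un uk].
have anti k : (k <= n)%N -> complex.Im (u k) = - complex.Re (u k).
  elim: k => [_|k IHk kn].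
    apply: (mulfI (lt0r_neq0 tB_gt0)); move: u0.
    by rewrite /north_west /south_west; lra.
  have [] := uk k kn; move: (IHk (ltnW kn)).
  rewrite /north_east /north_west /south_east /south_west.
  move: (u k) (u k.+1) => [x y] [x' y'] /= -> e1 e2.
  have tL : t * (y' - t * x') = - (1 - t) * x by lra.
  (* The left boundary equation [north_west = south_west] reappears at site [k.+1], which gives
     [y' = - x'] as in the base case. *)
  have e3 : (1 - t ^+ 2) * (t * y' - x') = (1 - t ^+ 2) * (y' - t * x').
    rewrite e2; transitivity ((1 + t ^+ 2) * (y' - t * x') + 2 * t * ((1 - t) * x)).
      by ring.
    have -> : (1 - t) * x = - (t * (y' - t * x')) by lra.
    by ring.
  by apply: (mulfI (lt0r_neq0 tB_gt0)); have := mulfI tsq_neq0 e3; lra.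
have zero k : (k <= n)%N -> complex.Re (u k) = 0 -> u k = 0.
  by move=> /anti; case: (u k) => x y /= -> ->; rewrite oppr0.
move=> k kn; apply: (zero) => //; move: k kn.
(* A second induction, now from right to left: the right boundary equation gives [y = x] at site
   [n], and a zero at a site forces a zero at its left neighbour. *)
suff H j : (j <= n)%N -> complex.Re (u (n - j)%N) = 0.
  by move=> k kn; rewrite -(subKn kn) H // leq_subr.
elim: j => [_|j IHj jn].
  rewrite subn0; move: un (anti n (leqnn n)); rewrite /north_east /south_east.
  case: (u n) => x y /= e ey; apply: (mulfI (lt0r_neq0 tB_gt0)).
  by move: e; rewrite ey; lra.
have jn' : (n - j)%N = (n - j.+1).+1 by rewrite subnSK.
have [] := uk (n - j.+1)%N; first by rewrite -jn' leq_subr.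
rewrite -jn' (zero _ (leq_subr _ _) (IHj (ltnW jn))).
have := anti _ (leq_subr j.+1 n).
rewrite /north_east /north_west /south_east /south_west.
case: (u _) => x y /= -> e _; apply: (mulfI (lt0r_neq0 tB_gt0)).
by move: e; lra.
Qed.

(* The left boundary condition puts the value at the first site on a line, whose
   orthogonal direction is the form below; the other values follow from left to
   right. *)
Lemma transfers_eigen_inj n u mu : transfers n u (fun k => mu%:C * u k) ->
    (t - mu) * complex.Im (u 0%N) + (1 - mu * t) * complex.Re (u 0%N) = 0 ->
  forall k, (k <= n)%N -> u k = 0.
Proof.
(* The induction below divides by [mu]; for [mu = 0] the output vanishes and injectivity
   concludes. *)
move=> u_mu; have [mu0|mu_neq0] := eqVneq mu 0.
  move: u_mu => + _; rewrite mu0 (_ : (fun k => _) = fun=> 0).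
    exact: transfers_inj.
  by apply/boolp.funext => k; rewrite rmorph0 mul0r.
move: u_mu => [u0 un uk] ell.
elim=> [_|k IHk kn].
  move: u0 ell; rewrite /north_west /south_west; case: (u 0%N) => x y /=.
  rewrite !(mul0r, subr0, addr0) => e1 e2.
  (* This is the determinant of the system formed by the boundary equation and [ell]; it could
     vanish only if [mu = t] and [t ^+ 2 = 1]. *)
  have d_gt0 : 0 < (t - mu) ^+ 2 + (1 - mu * t) ^+ 2.
    rewrite lt0r addr_ge0 ?sqr_ge0 // paddr_eq0 ?sqr_ge0 // !sqrf_eq0.
    rewrite andbT; apply/negP=> /andP[/eqP e /eqP e'].
    by move/eqP: tsq_neq0; apply; rewrite -e' expr2; have -> : mu = t by lra.
  have d_neq0 := lt0r_neq0 d_gt0.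
  have e3 : (t - mu) * x = (1 - mu * t) * y by lra.
  have -> : x = 0.
    apply: (mulfI d_neq0); rewrite mulr0.
    transitivity ((t - mu) * ((t - mu) * x - (1 - mu * t) * y)
      + (1 - mu * t) * ((t - mu) * y + (1 - mu * t) * x)); first by ring.
    by rewrite e3 e2; ring.
  have -> : y = 0.
    apply: (mulfI d_neq0); rewrite mulr0.
    transitivity ((t - mu) * ((t - mu) * y + (1 - mu * t) * x)
      - (1 - mu * t) * ((t - mu) * x - (1 - mu * t) * y)); first by ring.
    by rewrite e3 e2; ring.
  by [].
have [] := uk k kn; rewrite (IHk (ltnW kn)).
rewrite /north_east /north_west /south_east /south_west.
case: (u _) => x y /=; rewrite !(mul0r, mulr0, subr0, addr0, sub0r) => e1 e2.
have e : y - t * x = 0.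
  by apply: (mulfI t2_neq0); lra.
have e' : t * y - x = 0.
  apply: (mulfI (mulf_neq0 tsq_neq0 mu_neq0)); move: e2; rewrite e; lra.
have x0 : x = 0.
  apply: (mulfI tsq_neq0); transitivity (t * (y - t * x) - (t * y - x)); first ring.
  by rewrite e e'; ring.
by have -> : y = 0; [move: e; rewrite x0; lra | rewrite x0].
Qed.

End TransferRelation.

(** * From the face equations to the transfer relation *)

Section Row.
Variables (R : realType) (beta : R).
Let t : R := expR (- (2 * beta)).

(* In the coordinate [z = v / lambda^3] on the vertical edges, every face
   equation becomes an equality of real linear forms. *)
Lemma massive_s_holomorphic_real (F : R[i] -> R[i]) c :
    massive_s_holomorphic beta F c ->
  let E := F (c + 2^-1) / lambda R ^+ 3 in let N := F (c + 'i / 2) in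
  let W := F (c - 2^-1) / lambda R ^+ 3 in let S := F (c - 'i / 2) in
  [/\ north_east t N = - (t * complex.Re E + complex.Im E),
      north_west t N = t * complex.Im W + complex.Re W,
      south_east t S = t * complex.Re E - complex.Im E &
      south_west t S = complex.Re W - t * complex.Im W].
Proof.
rewrite /massive_s_holomorphic /= /nu -/t.
have := lambda_sqr R; have := lambda_conj R; have := lambda_neq0 R.
move: (lambda R) => l l0 lc l2.
have l30 : l ^+ 3 != 0 by rewrite expf_neq0.
have l4 : l ^+ 4 = -1 by rewrite (exprM _ 2 2) l2 sqrci.
have l6 : l ^+ 6 = - 'i by rewrite (exprD _ 4 2) l4 l2 mulN1r.
have li6 : l ^- 6 = 'i.
  apply: (mulIf (expf_neq0 6 l0)); rewrite mulVf ?expf_neq0 //.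
  by rewrite l6 mulrN -expr2 sqrci opprK.
have w0 : t%:C + 'i != 0 := tDi_neq0 t; have w0' : t%:C - 'i != 0 := tBi_neq0 t.
move: (F (c + 2^-1)) (F (c + 'i / 2)) (F (c - 2^-1)) (F (c - 'i / 2)).
move=> E N W S; set E' := E / _; set W' := W / _.
have EE : E = l ^+ 3 * E' by rewrite mulrC divfK.
have WE : W = l ^+ 3 * W' by rewrite mulrC divfK.
clearbody E' W'; subst E W; move: E' W' => E W.
have cE : (l ^+ 3 * E)^* = l ^- 3 * E^*.
  by rewrite rmorphM rmorphXn /= lc exprVn.
have cW : (l ^+ 3 * W)^* = l ^- 3 * W^*.
  by rewrite rmorphM rmorphXn /= lc exprVn.
rewrite cE cW => - [e1 e2 e3 e4].
(* Clearing the denominators of [nu] and reducing powers of [lambda] makes both sides of each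
   equation a real multiple or an imaginary multiple of 1, so each amounts to one real equation. *)
have f1 : (t%:C + 'i) * N - (t%:C - 'i) * N^* =
    - 'i * ((t%:C - 'i) * E + (t%:C + 'i) * E^*).
  transitivity ((t%:C + 'i) * N + l ^+ 4 * (t%:C - 'i) * N^*).
    by rewrite l4; ring.
  transitivity (l ^+ 6 * (t%:C - 'i) * E + l ^- 2 * (t%:C + 'i) * E^*).
    move: w0 w0' l0 e1; clear.
    move: (t%:C + 'i) (t%:C - 'i) l => w w' l w0 w0' l0 e1.
    transitivity (w * (N + (l ^- 3 * (w / w'))^-1 * l * N^*)).
      by field; rewrite w0 w0' l0.
    by rewrite e1; field; rewrite w0 w0' l0.
  by rewrite l6 l2 invCi; ring.
have f2 : (t%:C - 'i) * N - (t%:C + 'i) * N^* =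
    (t%:C + 'i) * W - (t%:C - 'i) * W^*.
  transitivity ((t%:C - 'i) * N + l ^- 4 * (t%:C + 'i) * N^*).
    by rewrite l4 invrN invr1; ring.
  transitivity ((t%:C + 'i) * W + l ^- 4 * (t%:C - 'i) * W^*).
    move: w0 w0' l0 e2; clear.
    move: (t%:C + 'i) (t%:C - 'i) l => w w' l w0 w0' l0 e1.
    transitivity (w' * (N + l ^- 3 * (w / w') * l^-1 * N^*)).
      by field; rewrite w0' l0.
    by rewrite e1; field; rewrite w0' l0.
  by rewrite l4 invrN invr1; ring.
have f3 : (t%:C - 'i) * S + (t%:C + 'i) * S^* =
    (t%:C + 'i) * E + (t%:C - 'i) * E^*.
  move: w0 w0' l0 e3; clear; move: (t%:C + 'i) (t%:C - 'i) l => w w' l w0 w0' l0 e1.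
  transitivity (w' * (S + l ^- 3 * (w / w') * l ^+ 3 * S^*)).
    by field; rewrite w0' l0.
  by rewrite e1; field; rewrite w0' l0.
have f4 : (t%:C + 'i) * S + (t%:C - 'i) * S^* =
    - 'i * ((t%:C - 'i) * W - (t%:C + 'i) * W^*).
  transitivity (l ^+ 6 * (t%:C - 'i) * W + l ^- 6 * (t%:C + 'i) * W^*).
    move: w0 w0' l0 e4; clear.
    move: (t%:C + 'i) (t%:C - 'i) l => w w' l w0 w0' l0 e1.
    transitivity (w * (S + (l ^- 3 * (w / w'))^-1 * l ^- 3 * S^*)).
      by field; rewrite w0 w0' l0.
    by rewrite e1; field; rewrite w0 w0' l0.
  by rewrite li6 l6; ring.
move: f1 f2 f3 f4; clear; rewrite /north_east /north_west /south_east /south_west.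
move: E N W S => [ex ey] [nx ny] [wx wy] [sx sy]; rewrite !conjE imE; simpc.
move=> /=.
move=> [f1 f1'] [f2 f2'] [f3 f3'] [f4 f4'].
by split; lra.
Qed.

(** Index type [nat] suits [transfers]; the default 0 makes [coef0] and [coefZ] valid at every
    index. *)
Definition coef a b (f : config R a b) (j : nat) : R[i] :=
  if insub j is Some k then f k else 0.

Lemma coef_ord a b (f : config R a b) (k : 'I_(width a b)) : coef f k = f k.
Proof. by rewrite /coef valK. Qed.

Variables (a b : int) (hab : a < b) (hbeta : 0 < beta).

(** An inner vertical edge is the east edge of one face and the west edge of the next. Writing all
    the forms at these two faces through its two real coordinates turns the inner relations into
    polynomial identities. *)
Lemma propagator_transfers (f : config R a b) :
  transfers t (width a b).-1 (coef f) (coef (propagator hab hbeta f)).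
Proof.
have := width_gt0 hab; have := vert_last R hab; have := vert_first R a.
have [h] := extension_exists f hab hbeta => hf.
have gh := propagatorE hab hbeta hf; move: hf => [fh face left right].
have l4 : lambda R ^+ 4 = -1 by rewrite (exprM _ 2 2) lambda_sqr sqrci.
move: (propagator hab hbeta f) gh => g gh v0E vnE n_gt0.
have coefE k (hk : (k < width a b)%N) :
    h (dual_pt a 0 k) = coef f k /\ h (dual_pt a 1 k) = coef g k.
  have := fh (Ordinal hk); have := gh (Ordinal hk).
  by rewrite -!coef_ord => <- <-.
pose v j := h (vert_pt R a j) / lambda R ^+ 3.
have faceE k (hk : (k < width a b)%N) :
  [/\ north_east t (coef g k) =
        - (t * complex.Re (v k.+1) + complex.Im (v k.+1)),
      north_west t (coef g k) = t * complex.Im (v k) + complex.Re (v k),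
      south_east t (coef f k) =
        t * complex.Re (v k.+1) - complex.Im (v k.+1) &
      south_west t (coef f k) = complex.Re (v k) - t * complex.Im (v k)].
  have := massive_s_holomorphic_real (face (Ordinal hk)).
  have [-> -> -> ->] := face_pts R a k.
  by have [-> ->] := coefE k hk.
(* Division by [lambda ^+ 3] sends the left boundary line to the real axis and the right one to the
   imaginary axis. *)
have v0 : complex.Im (v 0%N) = 0.
  have [r hr] := left; rewrite /v v0E hr -mulrA -invfM -exprS l4.
  by rewrite invrN invr1 mulrN1 /= oppr0.
have vn : complex.Re (v (width a b)) = 0.
  have [r hr] := right; rewrite /v vnE hr [_ ^+ 3]exprS.
  rewrite invfM mulrA mulfK ?lambda_neq0 // lambda_sqr.
  by rewrite invCi mulrN imE; simpc.
split=> [||k kn].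
- by have [_ -> _ ->] := faceE 0%N n_gt0; rewrite v0; ring.
- move: (faceE (width a b).-1); rewrite prednK // => /(_ (leqnn _))[-> _ -> _].
  by rewrite vn; ring.
have kn' : (k.+1 < width a b)%N by rewrite -ltn_predRL.
have [-> _ -> _] := faceE k (ltnW kn'); have [_ -> _ ->] := faceE k.+1 kn'.
by split; ring.
Qed.
End Row.

(** * Row-vector coordinates on configurations *)

Section Coordinates.
Variables (R : realType) (a b : int).
Local Notation n := (width a b).

Definition row_of_config (f : config R a b) : 'rV[R]_(n + n) :=
  row_mx (\row_k complex.Re (f k)) (\row_k complex.Im (f k)).

Definition config_of_row (v : 'rV[R]_(n + n)) : config R a b :=
  [ffun k => (v 0 (lshift n k) +i* v 0 (rshift n k)) : Rcomplex R].

Lemma row_of_configK : cancel row_of_config config_of_row.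
Proof.
move=> f; apply/ffunP => k; rewrite ffunE row_mxEl row_mxEr !mxE.
by case: (f k).
Qed.

Lemma config_of_rowK : cancel config_of_row row_of_config.
Proof.
move=> v; apply/rowP => i; rewrite /row_of_config.
by case: (split_ordP i) => k ->; rewrite ?row_mxEl ?row_mxEr mxE ffunE.
Qed.

Fact row_of_config_is_linear : linear row_of_config.
Proof.
move=> x f g; rewrite /row_of_config scale_row_mx add_row_mx.
by congr row_mx; apply/rowP => k; rewrite !mxE !ffunE;
  case: (f k) (g k) => [? ?] [? ?].
Qed.

HB.instance Definition _ :=
  GRing.isLinear.Build R (config R a b) 'rV[R]_(n + n) _ row_of_config
    row_of_config_is_linear.

Fact config_of_row_is_linear : linear config_of_row.
Proof.
by move=> x v w; rewrite -[RHS]row_of_configK linearP /= !config_of_rowK.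
Qed.

HB.instance Definition _ :=
  GRing.isLinear.Build R 'rV[R]_(n + n) (config R a b) _ config_of_row
    config_of_row_is_linear.

Lemma config_dotE (f g : config R a b) :
  config_dot f g = (row_of_config f *m (row_of_config g)^T) 0 0.
Proof.
rewrite mxE big_split_ord /= -big_split; apply: eq_bigr => k _ /=.
by rewrite ![_^T _ _]mxE !row_mxEl !row_mxEr !mxE.
Qed.

End Coordinates.

(** * Spectrum of the propagator *)

Section Spectrum.
Variables (R : realType) (a b : int) (hab : a < b) (beta : R).
Hypothesis hbeta : 0 < beta.
Local Notation n := (width a b).
Local Notation t := (expR (- (2 * beta))).
Implicit Types (f g : config R a b) (mu : R).
Local Notation P := (propagator hab hbeta).

Let t_gt0 : 0 < t. Proof. exact: expR_gt0. Qed.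
Let t_lt1 : t < 1. Proof. by rewrite expR_lt1 oppr_lt0 mulr_gt0. Qed.

Lemma prednK_width : n.-1.+1 = n.
Proof. by rewrite prednK // width_gt0. Qed.

Lemma coef_inj f g : (forall k, (k <= n.-1)%N -> coef f k = coef g k) -> f = g.
Proof.
move=> fg; apply/ffunP => k; rewrite -!coef_ord; apply: fg.
by rewrite -ltnS prednK_width.
Qed.

Lemma coef0 k : coef (0 : config R a b) k = 0.
Proof. by rewrite /coef; case: insub => // i; rewrite ffunE. Qed.

Lemma coefZ mu f k : coef (mu *: f) k = mu%:C * coef f k.
Proof.
rewrite /coef; case: insub => [i|]; last by rewrite mulr0.
by rewrite ffunE; case: (f i) => x y; simpc.
Qed.

Lemma config_dot_coef f g :
  config_dot f g = \sum_(k < n.-1.+1) dotC (coef f k) (coef g k).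
Proof.
by rewrite prednK_width; apply: eq_bigr => k _; rewrite !coef_ord.
Qed.

Lemma config_dotC f g : config_dot f g = config_dot g f.
Proof. by apply: eq_bigr => k _; rewrite mulrC [X in _ + X]mulrC. Qed.

Lemma propagator_sym f g : config_dot (P f) g = config_dot f (P g).
Proof.
rewrite [RHS]config_dotC !config_dot_coef.
by apply: (transfers_sym t_gt0 t_lt1); exact: propagator_transfers.
Qed.

Lemma propagatorP f g : transfers t n.-1 (coef f) (coef g) -> P f = g.
Proof.
move=> fg; apply: coef_inj; apply: (transfers_unique t_gt0 t_lt1) fg.
exact: propagator_transfers.
Qed.

Lemma eigen_transfers f mu : P f = mu *: f ->
  transfers t n.-1 (coef f) (fun k => mu%:C * coef f k).
Proof.
move=> Pf; rewrite (_ : (fun k => _) = coef (P f)).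
  exact: propagator_transfers.
by apply/boolp.funext => k; rewrite Pf coefZ.
Qed.

(** Positivity of [P] gives [0 <= mu * config_dot f f], and injectivity excludes [mu = 0]. *)
Lemma propagator_eigen_gt0 f mu : f != 0 -> P f = mu *: f -> 0 < mu.
Proof.
move=> f0 Pf; have dotf : 0 < config_dot f f.
  have dot_ge0 k : 0 <= complex.Re (f k) * complex.Re (f k)
      + complex.Im (f k) * complex.Im (f k).
    by rewrite addr_ge0 // -expr2 sqr_ge0.
  rewrite lt0r sumr_ge0 // andbT; apply: contraNneq f0 => /psumr_eq0P f0.
  apply/eqP/ffunP => k; rewrite ffunE; have := f0 (fun k _ => dot_ge0 k) k isT.
  case: (f k) => x y /= /eqP; rewrite paddr_eq0 -?expr2 ?sqr_ge0 // !sqrf_eq0.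
  by case/andP=> /eqP-> /eqP->.
have mu_neq0 : mu != 0.
  apply: contra_neq f0 => mu0; apply: coef_inj => k kn; rewrite coef0.
  apply: (transfers_inj t_gt0 t_lt1 _ kn).
  have := propagator_transfers hab hbeta f; rewrite Pf mu0 scale0r.
  by congr transfers; apply/boolp.funext => j; rewrite coef0.
have := transfers_psd t_gt0 t_lt1 (propagator_transfers hab hbeta f).
rewrite -config_dot_coef Pf config_dotE linearZ /= -scalemxAl mxE -config_dotE.
by rewrite pmulr_lge0 // lt0r mu_neq0.
Qed.

Lemma propagator_eigen_inv mu f : f != 0 -> mu != 0 -> P f = mu *: f ->
  exists2 g, g != 0 & P g = mu^-1 *: g.
Proof.
move=> f0 mu0 Pf; pose g : config R a b := [ffun k => swap (f k) : Rcomplex R].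
have gE k : coef g k = swap (coef f k).
  by rewrite /coef; case: insub => //= i; rewrite ffunE.
exists g.
  apply: contra f0 => /eqP g0; apply/eqP; apply: coef_inj => k _.
  by rewrite coef0; apply: swap_eq0; rewrite -gE g0 coef0.
(* Swapping the relation with input [f] and output [mu *: f] gives one with input [mu *: g] and
   output [g]. *)
suff Pg : P (mu *: g) = g.
  by rewrite -[in RHS]Pg linearZ scalerA mulVf // scale1r.
apply: propagatorP; have := transfers_swap t_gt0 t_lt1 (eigen_transfers Pf).
congr transfers; apply/boolp.funext => k /=; rewrite ?coefZ gE //.
by case: (coef f k) => x y; rewrite /swap; simpc.
Qed.

Lemma propagator_fixed f : P f = f -> f = 0.
Proof.
move=> Pf; apply: coef_inj => k kn; rewrite coef0.
apply: (transfers_fixed t_gt0 t_lt1 _ kn).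
by have := propagator_transfers hab hbeta f; rewrite Pf.
Qed.

Lemma propagator_eigen_simple mu f : P f = mu *: f ->
    (t - mu) * complex.Im (coef f 0) + (1 - mu * t) * complex.Re (coef f 0) = 0 ->
  f = 0.
Proof.
move=> Pf ell; apply: coef_inj => k kn; rewrite coef0.
exact: (transfers_eigen_inj t_gt0 t_lt1 (eigen_transfers Pf) ell).
Qed.

Definition propagator_mx : 'M[R]_(n + n) :=
  lin1_mx (@row_of_config R a b \o P \o @config_of_row R a b).

Lemma mul_propagator_mx v mu :
  v *m propagator_mx = mu *: v <-> P (config_of_row v) = mu *: config_of_row v.
Proof.
rewrite mul_rV_lin1 /=; split=> [e|->].
  by apply: (can_inj (@row_of_configK R a b)); rewrite e linearZ /= config_of_rowK.
by rewrite linearZ /= config_of_rowK.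
Qed.

Lemma propagator_mx_sym : propagator_mx^T = propagator_mx.
Proof.
have mxE' i j : propagator_mx i j =
    config_dot (P (config_of_row (delta_mx 0 i))) (config_of_row (delta_mx 0 j)).
  rewrite config_dotE config_of_rowK trmx_delta -colE [RHS]mxE.
  by rewrite [LHS]mxE.
by apply/matrixP => i j; rewrite mxE !mxE' propagator_sym config_dotC.
Qed.

Lemma propagator_mx_simple mu : (\rank (eigenspace propagator_mx mu) <= 1)%N.
Proof.
pose k0 := Ordinal (width_gt0 hab).
(* The form of [transfers_eigen_inj] at the leftmost site: [lshift] selects its real part, [rshift]
   its imaginary part. *)
pose c : 'cV[R]_(n + n) := (t - mu) *: delta_mx (rshift n k0) 0
  + (1 - mu * t) *: delta_mx (lshift n k0) 0.
apply: (mxrank_eigenspace_le1 (c := c)) => v /mul_propagator_mx Pv vc.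
apply: (can_inj (@config_of_rowK R a b)); rewrite linear0.
apply: (propagator_eigen_simple Pv); rewrite (coef_ord _ k0) ffunE /=.
have /matrixP/(_ 0 0) := vc; rewrite mulmxDr -!scalemxAr -!colE !mxE => <-.
by [].
Qed.

Lemma leigenvalueP mu :
  passmx.leigenvalue P mu <-> exists2 f, f != 0 & P f = mu *: f.
Proof.
rewrite /passmx.leigenvalue /passmx.leigenspace -subv0.
split=> [/subvPn[f]|[f f0 Pf]].
  rewrite memv_ker memv0 add_lfunE opp_lfunE scale_lfunE id_lfunE.
  rewrite subr_eq0 => /eqP Pf f0.
  by exists f.
apply/subvPn; exists f; last by rewrite memv0.
by rewrite memv_ker add_lfunE opp_lfunE scale_lfunE id_lfunE Pf subrr.
Qed.

Lemma leigenvalue_mx mu : passmx.leigenvalue P mu <-> eigenvalue propagator_mx mu.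
Proof.
rewrite leigenvalueP; split=> [[f f0 Pf]|/eigenvalueP[v /mul_propagator_mx Pv v0]].
  apply/eigenvalueP; exists (row_of_config f).
    by apply/mul_propagator_mx; rewrite row_of_configK.
  by rewrite -(inj_eq (can_inj (@row_of_configK R a b))) linear0 in f0.
exists (config_of_row v) => //.
by rewrite -(inj_eq (can_inj (@config_of_rowK R a b))) linear0 in v0.
Qed.

End Spectrum.

Theorem proposition7 (R : realType) (a b : int) (hab : a < b)
    (beta : R) (hbeta : 0 < beta) :
  let P := propagator hab hbeta in
  (forall f g : config R a b, config_dot (P f) g = config_dot f (P g)) /\
  exists lam : 'I_(width a b) -> R,
    [/\ injective lam,
        forall alpha, 1 < lam alpha &
        forall mu : R, passmx.leigenvalue P mu <->
          exists alpha, mu = lam alpha \/ mu = (lam alpha)^-1].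
Proof.
move=> P; split=> [f g|]; first exact: propagator_sym.
(* The family [d] lists [n + n] distinct eigenvalues, with [n] the width; what remains is to pair
   each with its inverse. *)
have [d [d_inj dE]] := symmetric_simple_spectrum
  (propagator_mx_sym hab hbeta) (propagator_mx_simple hab hbeta).
have eigE mu : passmx.leigenvalue P mu <-> exists i, mu = d i.
  by rewrite leigenvalue_mx dE.
have d_eig i : exists2 f, f != 0 & P f = d i *: f.
  by apply/leigenvalueP/eigE; exists i.
have d_gt0 i : 0 < d i.
  by have [f f0 Pf] := d_eig i; exact: (propagator_eigen_gt0 f0 Pf).
have d_neq1 i : d i != 1.
  have [f f0 Pf] := d_eig i; apply: contra_neq f0 => di1.
  by apply: (@propagator_fixed _ _ _ hab _ hbeta); rewrite Pf di1 scale1r.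
have d_inv i : exists j, d j = (d i)^-1.
  have [f f0 Pf] := d_eig i.
  have [j ->] : exists j, (d i)^-1 = d j; last by exists j.
  by apply/eigE/leigenvalueP; apply: propagator_eigen_inv f0 _ Pf; rewrite gt_eqF.
have [lam [lam_inj lam_gt1 lamE]] := enum_inverse_pairs d_inj d_gt0 d_neq1 d_inv.
by exists lam; split=> // mu; rewrite eigE lamE.
Qed.
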